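(* Let $A$ be a real finite-dimensional affine space. The mapping $P\in A\mapsto v_P\in(\mathrm{Quad}(A))^*=\widehat A^{\,2}$ is a quadratic immersion (an injective quadratic map). The linear inclusion $\mathrm{Aff}(A)\subset\mathrm{Quad}(A)$ determines a linear projector (its dual map) $\widehat A^{\,2}=(\mathrm{Quad}(A))^*\to(\mathrm{Aff}(A))^*=\widehat A$, whose composite with $P\mapsto v_P$ is the affine immersion $A\hookrightarrow\widehat A$, $P\mapsto z_P$.
   Context: All spaces are real and finite-dimensional. $\mathrm{Aff}(A)$ is the vector space of affine functions $A\to\mathbb R$; the linear hull is $\widehat A=(\mathrm{Aff}(A))^*$ and $z_P\in\widehat A$ is evaluation at $P$, $\langle z_P,f\rangle=f(P)$. A map $\delta:A\to B$ between affine spaces is quadratic if $\delta(\alpha P+\beta Q)=\alpha(\alpha-\beta)\delta(P)+\beta(\beta-\alpha)\delta(Q)+4\alpha\beta\,\delta(\frac{P+Q}2)$ for all $P,Q\in A$ and reals $\alpha+\beta=1$ (the right side is an affine combination in $B$). $\mathrm{Quad}(A)\supseteq\mathrm{Aff}(A)$ is the vector space of quadratic functions $A\to\mathbb R$. The quadratic hull is $\widehat A^{\,2}=(\mathrm{Quad}(A))^*$, and $v_P\in\widehat A^{\,2}$ is evaluation at $P$: $\langle v_P,\delta\rangle=\delta(P)$ for $\delta\in\mathrm{Quad}(A)$. *)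

(* Defs.v *)
From HB Require Import structures.
From mathcomp Require Import all_boot all_order all_algebra.
From mathcomp Require Import all_classical all_reals.
From mathcomp Require Import ring.

Set Implicit Arguments.
Unset Strict Implicit.
Unset Printing Implicit Defensive.

Import Order.TTheory GRing.Theory Num.Theory.

Local Open Scope ring_scope.

(* A (nonempty) affine space with space of translations V, i.e., a V-torsor.
   [V] is only a module here; finite dimension is imposed by taking
   [V : vectType R]. *)
HB.mixin Record isAffine (R : pzRingType) (V : lmodType R) (A : Type) := {
  translate : A -> V -> A;
  displacement : A -> A -> V; (* displacement Q P is the vector Q - P *)
  translateA : forall P u v,
    translate (translate P u) v = translate P (u + v);
  translateK : forall P u, displacement (translate P u) P = u;
  displacementK : forall P Q, translate P (displacement Q P) = Q;
  affine_inhabited : inhabited A }.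

#[short(type="affineType")]
HB.structure Definition Affine (R : pzRingType) (V : lmodType R) :=
  {A of isAffine R V A}.

Section AffineCombinations.
Variables (R : pzRingType) (V : lmodType R) (A : affineType V).
Implicit Types (O P Q : A) (s : seq (R * A)).

Lemma displacementD O P Q :
  displacement P O = displacement P Q + displacement Q O :> V.
Proof.
by rewrite -{1}(displacementK Q P) -{1}(displacementK O Q) translateA
           translateK addrC.
Qed.

(* The affine combination of the weighted points in s; by acomb_origin it does
   not depend on the origin O as soon as the weights add up to 1. *)
Definition acomb O s : A :=
  translate O (\sum_(x <- s) x.1 *: displacement x.2 O : V).

Lemma acomb_origin O O' s :
  \sum_(x <- s) x.1 = 1 -> acomb O s = acomb O' s.
Proof.
move=> s1; rewrite /acomb; set u := \sum_(_ <- _) _; set u' := \sum_(_ <- _) _.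
suff -> : u = displacement O' O + u' by rewrite -translateA displacementK.
rewrite -[displacement _ _]scale1r -s1 scaler_suml -big_split /=.
by apply: eq_bigr => x _; rewrite -scalerDr addrC -displacementD.
Qed.

End AffineCombinations.

Section RegularAffine.
Variable R : pzRingType.

Let trA (P u v : R^o) : P + u + v = P + (u + v).
Proof. by rewrite addrA. Qed.

Let trK (P u : R^o) : P + u - P = u.
Proof. by rewrite addrC addKr. Qed.

Let dispK (P Q : R^o) : P + (Q - P) = Q.
Proof. by rewrite addrC subrK. Qed.

HB.instance Definition _ :=
  isAffine.Build R R^o R^o trA trK dispK (inhabits 0).

Lemma acomb_regular (P : R^o) (s : seq (R * R^o)) :
  \sum_(x <- s) x.1 = 1 -> acomb P s = \sum_(x <- s) x.1 *: x.2.
Proof.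
move=> s1; rewrite (acomb_origin _ (0 : R^o) s1) /acomb /translate /= add0r.
by apply: eq_bigr => x _; rewrite /displacement /= subr0.
Qed.

End RegularAffine.

Section Dual.
Variables (R : comPzRingType) (U : lmodType R).

Definition dual : Type := {linear U -> R^o}.

HB.instance Definition _ := gen_eqMixin dual.
HB.instance Definition _ := gen_choiceMixin dual.

Implicit Types z w : dual.

Lemma dualP z w : (forall x, z x = w x) <-> z = w.
Proof.
split=> [|-> //]; case: z => f [[fD] [fZ]]; case: w => g [[gD] [gZ]] /= fg.
have {}fg : f = g by apply/funext.
case: g / fg gD gZ => gD gZ.
by rewrite (Prop_irrelevance gD fD) (Prop_irrelevance gZ fZ).
Qed.

Definition dual0 : dual := \0 : {linear U -> R^o}.
Definition dual_opp z : dual := \- z : {linear U -> R^o}.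
Definition dual_add z w : dual := z \+ w : {linear U -> R^o}.
Definition dual_scale (a : R) z : dual := a \*: z : {linear U -> R^o}.

Let addA : associative dual_add.
Proof. by move=> x y z; apply/dualP => t /=; rewrite addrA. Qed.

Let addC : commutative dual_add.
Proof. by move=> x y; apply/dualP => t /=; rewrite addrC. Qed.

Let add0 : left_id dual0 dual_add.
Proof. by move=> x; apply/dualP => t /=; rewrite add0r. Qed.

Let addN : left_inverse dual0 dual_opp dual_add.
Proof. by move=> x; apply/dualP => t /=; rewrite addNr. Qed.

HB.instance Definition _ := GRing.isZmodule.Build dual addA addC add0 addN.

Let scaleA a b z : dual_scale a (dual_scale b z) = dual_scale (a * b) z.
Proof. by apply/dualP => t /=; rewrite scalerA. Qed.

Let scale1 : left_id 1 dual_scale.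
Proof. by move=> x; apply/dualP => t /=; rewrite scale1r. Qed.

Let scaleDr : right_distributive dual_scale +%R.
Proof. by move=> a x y; apply/dualP => t /=; rewrite scalerDr. Qed.

Let scaleDl z : {morph dual_scale^~ z : a b / a + b}.
Proof. by move=> a b; apply/dualP => t /=; rewrite scalerDl. Qed.

HB.instance Definition _ :=
  GRing.Zmodule_isLmodule.Build R dual scaleA scale1 scaleDr scaleDl.

Let trA (P u v : dual) : P + u + v = P + (u + v).
Proof. by rewrite addrA. Qed.

Let trK (P u : dual) : P + u - P = u.
Proof. by rewrite addrC addKr. Qed.

Let dispK (P Q : dual) : P + (Q - P) = Q.
Proof. by rewrite addrC subrK. Qed.

HB.instance Definition _ :=
  isAffine.Build R dual dual trA trK dispK (inhabits 0).

Lemma acomb_dual (P : dual) (s : seq (R * dual)) :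
  \sum_(x <- s) x.1 = 1 -> acomb P s = \sum_(x <- s) x.1 *: x.2.
Proof.
move=> s1; rewrite (acomb_origin _ (0 : dual) s1) /acomb /translate /= add0r.
by apply: eq_bigr => x _; rewrite /displacement /= subr0.
Qed.

End Dual.

Section DualMap.
Variables (R : comPzRingType) (U W : lmodType R) (f : {linear U -> W}).

Definition dual_map (z : dual W) : dual U := (z \o f : {linear U -> R^o}).

Fact dual_map_is_linear : linear dual_map.
Proof. by move=> a z w; apply/dualP. Qed.

HB.instance Definition _ :=
  GRing.isLinear.Build R (dual W) (dual U) *:%R dual_map dual_map_is_linear.

End DualMap.

Section QuadraticMaps.
Variables (R : realType) (V W : lmodType R).
Variables (A : affineType V) (B : affineType W).

Definition midpoint (P Q : A) : A := acomb P [:: (2^-1, P); (2^-1, Q)].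

Definition affine_map (f : A -> B) : Prop :=
  forall (P Q : A) (a b : R), a + b = 1 ->
  f (acomb P [:: (a, P); (b, Q)]) = acomb (f P) [:: (a, f P); (b, f Q)].

Definition quadratic_map (d : A -> B) : Prop :=
  forall (P Q : A) (a b : R), a + b = 1 ->
  d (acomb P [:: (a, P); (b, Q)]) =
  acomb (d P) [:: (a * (a - b), d P); (b * (b - a), d Q);
                  (4 * a * b, d (midpoint P Q))].

End QuadraticMaps.

Section Functions.
Variables (R : realType) (V : lmodType R) (A : affineType V).
Implicit Types f g : A -> R^o.

Lemma affine_mapE f : affine_map f <->
  forall (P Q : A) (a b : R), a + b = 1 ->
  f (acomb P [:: (a, P); (b, Q)]) = a * f P + b * f Q.
Proof.
split=> H P Q a b ab; rewrite H //.
  by rewrite acomb_regular !big_cons !big_nil /= ?addr0.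
by rewrite acomb_regular !big_cons !big_nil /= ?addr0.
Qed.

Lemma quadratic_mapE f : quadratic_map f <->
  forall (P Q : A) (a b : R), a + b = 1 ->
  f (acomb P [:: (a, P); (b, Q)]) =
  a * (a - b) * f P + b * (b - a) * f Q + 4 * a * b * f (midpoint P Q).
Proof.
have E (a b : R) : a + b = 1 ->
    a * (a - b) + (b * (b - a) + 4 * a * b) = 1.
  by move=> ab; have -> : b = 1 - a by [rewrite -ab addrAC subrr add0r]; ring.
split=> H P Q a b ab; rewrite H //.
  by rewrite acomb_regular !big_cons !big_nil /= ?addr0 ?E // addrA.
by rewrite acomb_regular !big_cons !big_nil /= ?addr0 ?E // -addrA.
Qed.

Lemma affine_quadratic f : affine_map f -> quadratic_map f.
Proof.
move=> /affine_mapE fA; apply/quadratic_mapE => P Q a b ab.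
have h : 2^-1 + 2^-1 = 1 :> R by rewrite -div1r -splitr.
rewrite /midpoint !fA //.
have -> : b = 1 - a by rewrite -ab addrAC subrr add0r.
by field.
Qed.

Definition aff_pred : {pred A -> R^o} := [pred f | `[< affine_map f >]].
Definition quad_pred : {pred A -> R^o} := [pred f | `[< quadratic_map f >]].

Fact aff_submod_closed : submod_closed aff_pred.
Proof.
split=> [|c f g /asboolP/affine_mapE fA /asboolP/affine_mapE gA];
    apply/asboolP/affine_mapE => P Q a b ab.
  by rewrite !mulr0 addr0.
rewrite !fctE fA // gA // /GRing.scale /=.
ring.
Qed.

Fact quad_submod_closed : submod_closed quad_pred.
Proof.
split=> [|c f g /asboolP/quadratic_mapE fA /asboolP/quadratic_mapE gA];
    apply/asboolP/quadratic_mapE => P Q a b ab.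
  by rewrite !mulr0 !addr0.
rewrite !fctE fA // gA // /GRing.scale /=.
ring.
Qed.

HB.instance Definition _ :=
  GRing.isSubmodClosed.Build R (A -> R^o) aff_pred aff_submod_closed.
HB.instance Definition _ :=
  GRing.isSubmodClosed.Build R (A -> R^o) quad_pred quad_submod_closed.

Record Aff := MkAff { aff_val :> A -> R^o; _ : aff_val \in aff_pred }.
Record Quad := MkQuad { quad_val :> A -> R^o; _ : quad_val \in quad_pred }.

HB.instance Definition _ := [isSub for aff_val].
HB.instance Definition _ := [Choice of Aff by <:].
HB.instance Definition _ := [SubChoice_isSubLmodule of Aff by <:].

HB.instance Definition _ := [isSub for quad_val].
HB.instance Definition _ := [Choice of Quad by <:].
HB.instance Definition _ := [SubChoice_isSubLmodule of Quad by <:].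

Fact aff_in_quad (f : Aff) : (f : A -> R^o) \in quad_pred.
Proof. by apply/asboolP/affine_quadratic/asboolP/(valP f). Qed.

Definition quad_of_aff (f : Aff) : Quad := MkQuad (aff_in_quad f).

Fact quad_of_aff_is_linear : linear quad_of_aff.
Proof. by move=> a f g; apply: val_inj. Qed.

HB.instance Definition _ :=
  GRing.isLinear.Build R Aff Quad *:%R quad_of_aff quad_of_aff_is_linear.

Definition linear_hull := dual Aff.
Definition quadratic_hull := dual Quad.

End Functions.

Arguments Aff {R V} A.
Arguments Quad {R V} A.
Arguments quad_of_aff {R V} A.
Arguments linear_hull {R V} A.
Arguments quadratic_hull {R V} A.

Section Evaluation.
Variables (R : realType) (V : lmodType R) (A : affineType V).

Section Eval.
Variable P : A.

Definition eval_aff (f : Aff A) : R^o := f P.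
Definition eval_quad (d : Quad A) : R^o := d P.

Fact eval_aff_is_linear : linear eval_aff.
Proof. by []. Qed.

Fact eval_quad_is_linear : linear eval_quad.
Proof. by []. Qed.

HB.instance Definition _ :=
  GRing.isLinear.Build R (Aff A) R^o *:%R eval_aff eval_aff_is_linear.
HB.instance Definition _ :=
  GRing.isLinear.Build R (Quad A) R^o *:%R eval_quad eval_quad_is_linear.

End Eval.

Definition z_ (P : A) : linear_hull A := eval_aff P : {linear Aff A -> R^o}.
Definition v_ (P : A) : quadratic_hull A :=
  eval_quad P : {linear Quad A -> R^o}.

Definition hull_proj : quadratic_hull A -> linear_hull A :=
  dual_map (quad_of_aff A).

End Evaluation.

Arguments z_ {R V A}.
Arguments v_ {R V A}.
Arguments hull_proj {R V} A.

(* Main.v *)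
Require Import Defs.
From mathcomp Require Import all_boot all_order all_algebra.
From mathcomp Require Import all_classical all_reals.
From mathcomp Require Import ring.
From HB Require Import structures.
Import GRing.Theory.
Local Open Scope ring_scope.

(** Every structural identity is tested on functions: a point of a dual space
    is determined by its values, and the value of [v_ P] at [d] (of [z_ P] at
    [f]) is just [d P] ([f P]).  Hence [v_] is quadratic because each [d] is,
    [z_] is affine because each [f] is, and the projector sends [v_ P] to
    [z_ P] because [quad_of_aff] does not change the underlying function.

    Finite dimension enters through a basis [e_i] of [V].  The coordinates of
    [P - Q] in this basis are affine functions of [P] vanishing at [Q], so
    affine functions separate the points of [A], and [z_] is injective
    ([z_inj]); since [z_] factors through [v_], so is [v_].

    For the surjectivity of the projector, it is enough that [Aff A] be a
    retract of [Quad A]: if [r] is a linear retraction, then [z \o r] projects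
    to [z].  Such an [r] ([interpolation]) is affine interpolation at an origin
    [O] and the points [O + e_i]: it is linear in the interpolated function, and
    it reproduces every affine function, as the latter is determined by its
    values at these points ([interpolationK]). *)

Section AffineFunctions.
Context {R : realType} {V : lmodType R} {A : affineType V}.
Implicit Types (O P Q : A) (f : Aff A).

Lemma displacement_refl P : displacement P P = 0 :> V.
Proof.
by apply: (addrI (displacement P P : V)); rewrite -displacementD addr0.
Qed.

Lemma displacement_comb O P Q (a b : R) : a + b = 1 ->
  displacement (acomb P [:: (a, P); (b, Q)]) O =
  a *: displacement P O + b *: displacement Q O :> V.
Proof.
move=> ab; rewrite (acomb_origin _ O) ?big_cons ?big_nil /= ?addr0 //.
by rewrite /acomb translateK !big_cons big_nil /= addr0.
Qed.

Lemma translate_comb O (u w : V) (a b : R) : a + b = 1 ->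
  acomb (translate O u) [:: (a, translate O u); (b, translate O w)] =
  translate O (a *: u + b *: w) :> A.
Proof.
move=> ab; rewrite -[LHS](displacementK O) displacement_comb //.
by rewrite !translateK.
Qed.

Lemma translate0 O : translate O 0 = O.
Proof. by rewrite -(displacement_refl O) displacementK. Qed.

Lemma affE f P Q (a b : R) : a + b = 1 ->
  f (acomb P [:: (a, P); (b, Q)]) = a * f P + b * f Q.
Proof. by have /asboolP/affine_mapE fA := valP f; exact: fA. Qed.

Lemma linear_aff_pred O (c : R) (phi : {linear V -> R^o}) :
  (fun P => c + phi (displacement P O) : R^o) \in @aff_pred R V A.
Proof.
apply/asboolP/affine_mapE => P Q a b ab.
rewrite displacement_comb // linearP linearZ /= /GRing.scale /=.
by rewrite -{1}[c]mul1r -ab; ring.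
Qed.

Definition linear_part O f (u : V) : R^o := f (translate O u) - f O.

(** Homogeneity is affinity along the line through [O] and [O + u]; additivity
    follows because [u + w] is the midpoint of [2u] and [2w]. *)
Lemma linear_part_is_linear O f : linear (linear_part O f).
Proof.
have fZ a u : linear_part O f (a *: u) = a * linear_part O f u.
  have a1 : a + (1 - a) = 1 by rewrite addrC subrK.
  have := affE f (translate O u) (translate O 0) a (1 - a) a1.
  rewrite translate_comb // scaler0 addr0 translate0 /linear_part => ->.
  by ring.
have fD u w : linear_part O f (u + w) = linear_part O f u + linear_part O f w.
  have h : 2^-1 + 2^-1 = 1 :> R by field.
  have n2 : (2 : R) != 0 by rewrite Num.Theory.pnatr_eq0.
  have := affE f (translate O (2 *: u)) (translate O (2 *: w)) _ _ h.
  rewrite translate_comb // !scalerA mulVf // !scale1r.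
  have := fZ 2 u; have := fZ 2 w; rewrite /linear_part.
  move=> /(canRL (subrK _)) -> /(canRL (subrK _)) -> ->.
  by field.
by move=> a u w; rewrite fD fZ.
Qed.

HB.instance Definition _ O f :=
  GRing.isLinear.Build R V R^o *:%R (linear_part O f)
    (linear_part_is_linear O f).

End AffineFunctions.

Section Interpolation.
Context {R : realType} {V : vectType R} {A : affineType V}.
Implicit Types (O P : A) (d : Quad A).

Let e := vbasis {: V}.

Definition interpolation_linear_part O d (u : V) : R^o :=
  \sum_i coord e i u * (d (translate O e`_i) - d O).

Lemma interpolation_linear_part_is_linear O d :
  linear (interpolation_linear_part O d).
Proof.
move=> a u w; rewrite /interpolation_linear_part scaler_sumr -big_split /=.
by apply: eq_bigr => i _; rewrite linearP mulrDl scalerAl.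
Qed.

HB.instance Definition _ O d :=
  GRing.isLinear.Build R V R^o *:%R (interpolation_linear_part O d)
    (interpolation_linear_part_is_linear O d).

Definition interpolation O d : Aff A :=
  MkAff (linear_aff_pred O (d O) (interpolation_linear_part O d)).

Lemma interpolation_is_linear O : linear (interpolation O).
Proof.
move=> a d d'; apply: val_inj; apply/funext => P /=.
rewrite !fctE /= /interpolation_linear_part [in RHS]/GRing.scale /=.
rewrite mulrDr addrACA mulr_sumr -big_split /=; congr (_ + _).
apply: eq_bigr => i _; rewrite !fctE /GRing.scale /=; ring.
Qed.

HB.instance Definition _ O :=
  GRing.isLinear.Build R (Quad A) (Aff A) *:%R (interpolation O)
    (interpolation_is_linear O).

(** Both sides have the same value at [O] and linear parts that agree on the
    basis. *)
Lemma interpolationK O : cancel (quad_of_aff A) (interpolation O).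
Proof.
move=> f; apply: val_inj; apply/funext => P /=.
rewrite -[in RHS](displacementK O P) -[RHS](subrK (f O)) addrC.
congr (_ + _); rewrite -/(linear_part O f _).
set u := displacement P O; rewrite [in RHS](coord_vbasis (memvf u)).
by rewrite linear_sum; apply: eq_bigr => i _; rewrite linearZ.
Qed.

Lemma hull_proj_surj (z : linear_hull A) :
  exists v : quadratic_hull A, hull_proj A v = z.
Proof.
have [O] : inhabited A := affine_inhabited.
exists (dual_map (interpolation O) z).
by apply/dualP => f /=; rewrite interpolationK.
Qed.

Lemma z_inj : injective (@z_ R V A).
Proof.
move=> P Q zPQ; rewrite -(displacementK Q P).
suff -> : displacement P Q = 0 :> V by rewrite translate0.
rewrite (coord_vbasis (memvf (displacement P Q))) big1 // => i _.
(* The test function is the i-th coordinate with origin Q. *)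
have /dualP/(_ (MkAff (linear_aff_pred Q 0 (coord e i)))) := zPQ.
rewrite /= /eval_aff /= displacement_refl linear0 !add0r => ->.
by rewrite scale0r.
Qed.

End Interpolation.

Section Evaluation.
Context {R : realType} {V : lmodType R} {A : affineType V}.

Lemma hull_proj_v (P : A) : hull_proj A (v_ P) = z_ P.
Proof. by apply/dualP. Qed.

Lemma dual_sumE (U : lmodType R) (s : seq (R * dual U)) (x : U) :
  (\sum_(y <- s) y.1 *: y.2 : dual U) x = \sum_(y <- s) y.1 * y.2 x.
Proof.
elim: s => [|y s IHs]; first by rewrite !big_nil.
by rewrite !big_cons -IHs.
Qed.

Lemma z_affine : affine_map (fun P : A => z_ P).
Proof.
move=> P Q a b ab; apply/dualP => f.
rewrite acomb_dual ?dual_sumE !big_cons !big_nil /= ?addr0 //.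
exact: affE.
Qed.

Lemma v_quadratic : quadratic_map (fun P : A => v_ P).
Proof.
move=> P Q a b ab; apply/dualP => d.
have /asboolP/quadratic_mapE dQ := valP d.
rewrite acomb_dual ?dual_sumE !big_cons !big_nil /= ?addr0.
  by rewrite addrA; exact: dQ.
(* The coefficients add up to (a + b) ^+ 2. *)
by rewrite -[RHS](expr1n _ 2) -[in RHS]ab; ring.
Qed.

End Evaluation.

Theorem proposition5p1 (R : realType) (V : vectType R) (A : affineType V) :
  (quadratic_map (fun P : A => v_ P) /\ injective (fun P : A => v_ P)) /\
  (linear (hull_proj A) /\
   forall z : linear_hull A, exists v : quadratic_hull A, hull_proj A v = z) /\
  (forall P : A, hull_proj A (v_ P) = z_ P) /\
  (affine_map (fun P : A => z_ P) /\ injective (fun P : A => z_ P)).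
Proof.
split; first split; [exact: v_quadratic| |].
  by move=> P Q vPQ; apply: z_inj; rewrite -!hull_proj_v vPQ.
split; first by split; [exact: dual_map_is_linear | exact: hull_proj_surj].
split; [exact: hull_proj_v | split; [exact: z_affine | exact: z_inj]].
Qed.
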